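(* Let $\mathbb{D}=\{z\in\mathbb{C}:|z|<1\}$. Suppose that $f(z)=\sum_{n=0}^{\infty}a_nz^n$ is analytic in $\mathbb{D}$ with $|f(z)|\le 1$ for all $z\in\mathbb{D}$. Let $f_0(z)=f(z)-a_0$, let $\|f_0\|_r^2=\sum_{n=1}^{\infty}|a_n|^2r^{2n}$, and let $S_r$ denote the area of the image of the subdisk $|z|<r$ under $f$. Then $$\sum_{n=0}^{\infty}|a_n|r^n+\left(\frac{1}{1+|a_0|}+\frac{r}{1-r}\right)\|f_0\|_r^2+\frac{8}{9}\left(\frac{S_r}{\pi}\right)+\lambda\left(\frac{S_r}{\pi}\right)^2\le 1\quad\text{for } 0\le r\le\frac13,$$ where $$\lambda=\frac{-2673+2502a_*+2025a_*^2-332a_*^3-255a_*^4+6a_*^5+7a_*^6}{162(a_*+1)^3(5a_*-3)}\approx 14.796883$$ and $a_*\approx 0.587459$ is the unique root in $(0,1)$ of the equation $\psi(t)=0$, where $$\psi(t)=2t^8+4t^7-4t^6-76t^5-1344t^4-1396t^3+12420t^2+15804t-13122.$$ Equality in the inequality $$\sum_{n=0}^{\infty}|a_n|r^n+\left(\frac{1}{1+|a_0|}+\frac{r}{1-r}\right)\|f_0\|_r^2+\frac{8}{9}\left(\frac{S_r}{\pi}\right)+\lambda\left(\frac{S_r}{\pi}\right)^2\le 1$$ is achieved for the function $f(z)=\frac{a-z}{1-az}$ with $a=a_*$ and $r=\frac13$.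
   Context: The area $S_r$ of the image of $\{|z|<r\}$ under $f$ is counted with multiplicity, i.e. $\frac{S_r}{\pi}=\sum_{n=1}^{\infty}n|a_n|^2r^{2n}$.
   Formalization: The printed value λ ≈ 14.796883 is not correct to all its digits (the given formula at the exact root a_* yields about 14.796997); the formal statement asserts |λ − 14.796883| ≤ 1.2·10⁻⁴ and uses the exact formula for λ in the inequality. *)

(* Defs.v *)
From Stdlib Require Import Reals.
From Coquelicot Require Import Coquelicot.
Open Scope R_scope.

(* f is given on the open unit disk by its Maclaurin series, which is what
   being analytic there means.  Values of f outside the disk are irrelevant.
   All real series below then converge absolutely for 0 <= r < 1, so the total
   operator Series denotes their genuine sums. *)
Definition bounded_analytic (f : C -> C) (a : nat -> C) : Prop :=
  forall z : C, Cmod z < 1 ->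
    is_pseries (K := C_AbsRing) (V := C_NormedModule) a z (f z) /\
    Cmod (f z) <= 1.

Definition majorant_series (a : nat -> C) (r : R) : R :=
  Series (fun n => Cmod (a n) * r ^ n).

(* ||f_0||_r^2 with f_0 = f - a_0; the summation index is n + 1. *)
Definition norm_f0_sq (a : nat -> C) (r : R) : R :=
  Series (fun n => Cmod (a (S n)) ^ 2 * r ^ (2 * S n)).

(* S_r: area of the image of |z| < r under f, counted with multiplicity.
   The n = 0 term vanishes. *)
Definition area (a : nat -> C) (r : R) : R :=
  PI * Series (fun n => INR n * Cmod (a n) ^ 2 * r ^ (2 * n)).

Definition bohr_functional (lam : R) (a : nat -> C) (r : R) : R :=
  majorant_series a r
  + (/ (1 + Cmod (a 0%nat)) + r / (1 - r)) * norm_f0_sq a r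
  + 8 / 9 * (area a r / PI)
  + lam * (area a r / PI) ^ 2.

Definition psi (t : R) : R :=
  2 * t ^ 8 + 4 * t ^ 7 - 4 * t ^ 6 - 76 * t ^ 5 - 1344 * t ^ 4
  - 1396 * t ^ 3 + 12420 * t ^ 2 + 15804 * t - 13122.

Definition lambda (t : R) : R :=
  (- 2673 + 2502 * t + 2025 * t ^ 2 - 332 * t ^ 3 - 255 * t ^ 4
   + 6 * t ^ 5 + 7 * t ^ 6)
  / (162 * (t + 1) ^ 3 * (5 * t - 3)).

Definition disk_automorphism (t : R) (z : C) : C :=
  ((RtoC t - z) / (1 - RtoC t * z))%C.

(* Main.v *)
Require Import Defs.
From Stdlib Require Import Reals Lra Lia.
From Coquelicot Require Import Coquelicot.
Open Scope R_scope.

(** Write [A n] for the modulus of the [n]-th coefficient of [f] and [al = A 0].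

    Since [f] is bounded by 1, multiplication by [f] does not increase the l2
    norm of coefficient sequences ([toeplitz_contraction]).  All the coefficient
    inequalities come from testing this contraction on well chosen polynomials.

    - Carlson's inequalities [odd_coef_bound] and [even_coef_bound] bound each
      [A n] by [1] minus the squares of the first half of the coefficients.
      Multiplied by [r ^ n] and added up, the subtracted squares assemble into
      exactly [(1 / (1 + al) + r / (1 - r)) * norm_f0_sq], which gives
      [bohr_inequality]: the first two terms of the functional are together at
      most [al + (1 - al ^ 2) * r / (1 - r)].
    - [coef_sq_bound] says that every new coefficient uses up at most the
      proportion [1 - al ^ 2] of the energy still available, so that the energy
      of the first coefficients is at most that of the disk automorphism with
      value [al] at 0.  Summation by parts with the weights [n * r ^ (2 * n)],
      which decrease when [r ^ 2 <= 1 / 2], turns this into the sharp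
      [area_bound].

    Both bounds are attained by the automorphism [(al - z) / (1 - al * z)] and
    increase with [r], so the functional is at most its value
    [extremal_value lam al] for that automorphism at [r = 1 / 3].  One computes
    that, for [a < 1], [1 - extremal_value lam a] has the sign of
    [crit_num a - 162 * lam * crit_den a].  The polynomial [psi] is the numerator
    of the derivative of [crit_num / crit_den], up to a factor without zeros in
    the open unit interval; at its root [t] in this interval the value of
    [crit_num / crit_den] is [162 * lambda t], and there
    [crit_num - 162 * lambda t * crit_den] has a double zero whose cofactor is
    positive on the unit interval ([crit_num_ge]).  Hence the functional is at most 1, with equality for the
    automorphism with parameter [t]. *)

(** * Mean values over roots of unity *)

Lemma sum_n_C_S (u : nat -> C) (n : nat) :
  sum_n u (S n) = (sum_n u n + u (S n))%C.
Proof. exact (sum_Sn u n). Qed.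

Definition cpoly (c : nat -> C) (m : nat) (z : C) : C :=
  sum_n (fun k => c k * z ^ k)%C m.

Lemma cpoly_S (c : nat -> C) (m : nat) (z : C) :
  cpoly c (S m) z = (cpoly c m z + c (S m) * z ^ S m)%C.
Proof. exact (sum_Sn _ _). Qed.

Lemma cpoly_0 (c : nat -> C) (z : C) : cpoly c 0 z = c 0%nat.
Proof. unfold cpoly; rewrite sum_O; simpl; ring. Qed.

Lemma cpoly_shift (c : nat -> C) (m : nat) (z : C) :
  cpoly c (S m) z = (c 0%nat + z * cpoly (fun k => c (S k)) m z)%C.
Proof.
  induction m as [|m IH].
  - rewrite cpoly_S, !cpoly_0; simpl; ring.
  - rewrite cpoly_S, IH, (cpoly_S (fun k => c (S k))); simpl; ring.
Qed.

Definition cis (x : R) : C := (cos x, sin x).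

Lemma cis_plus (x y : R) : cis (x + y) = (cis x * cis y)%C.
Proof.
  unfold cis, Cmult; simpl; rewrite cos_plus, sin_plus; f_equal; ring.
Qed.

Lemma cis_pow (x : R) (k : nat) : (cis x ^ k)%C = cis (INR k * x).
Proof.
  induction k as [|k IH].
  - simpl; rewrite Rmult_0_l; unfold cis; now rewrite cos_0, sin_0.
  - rewrite Cpow_S, IH, <- cis_plus, S_INR; f_equal; ring.
Qed.

Lemma Cmod_cis (x : R) : Cmod (cis x) = 1.
Proof.
  unfold Cmod, cis; simpl.
  replace (cos x * (cos x * 1) + sin x * (sin x * 1)) with (Rsqr (sin x) + Rsqr (cos x))
    by (unfold Rsqr; ring).
  rewrite sin2_cos2; exact sqrt_1.
Qed.

Lemma cis_neq_1 (x : R) : 0 < x < 2 * PI -> cis x <> 1.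
Proof.
  intros Hx E; injection E as E _.
  assert (Hs : 0 < sin (x / 2)) by (apply sin_gt_0; lra).
  replace x with (2 * (x / 2)) in E by field.
  rewrite cos_2a_sin in E; nra.
Qed.

(** The circle integral is replaced by the mean over the roots of unity of order
    [S n]: it integrates trigonometric polynomials of degree at most [n] exactly. *)
Definition circle_mean (n : nat) (F : C -> R) : R :=
  sum_f_R0 (fun l => F (cis (2 * PI * INR l / INR (S n)))) n / INR (S n).

Lemma circle_mean_plus n F G :
  circle_mean n (fun z => F z + G z) = circle_mean n F + circle_mean n G.
Proof.
  unfold circle_mean; rewrite sum_plus; field; rewrite S_INR.
  pose proof (pos_INR n); lra.
Qed.

Lemma circle_mean_scal n k F :
  circle_mean n (fun z => k * F z) = k * circle_mean n F.
Proof.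
  unfold circle_mean, Rdiv; rewrite <- Rmult_assoc; f_equal.
  rewrite scal_sum; apply sum_eq; intros; ring.
Qed.

Lemma circle_mean_const n k : circle_mean n (fun _ => k) = k.
Proof.
  unfold circle_mean; rewrite sum_cte; field; rewrite S_INR.
  pose proof (pos_INR n); lra.
Qed.

Lemma circle_mean_le n F G :
  (forall z, Cmod z = 1 -> F z <= G z) -> circle_mean n F <= circle_mean n G.
Proof.
  intros H; unfold circle_mean.
  apply Rmult_le_compat_r.
  - rewrite S_INR; apply Rlt_le, Rinv_0_lt_compat; pose proof (pos_INR n); lra.
  - apply sum_Rle; intros; apply H, Cmod_cis.
Qed.

Lemma circle_mean_ext n F G :
  (forall z, Cmod z = 1 -> F z = G z) -> circle_mean n F = circle_mean n G.
Proof.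
  intros H; apply Rle_antisym; apply circle_mean_le; intros z Hz;
    rewrite (H z Hz); apply Rle_refl.
Qed.

(** The powers of a nontrivial root of unity form a geometric progression, so
    their sum telescopes after division by [cis x - 1], and it closes up because
    [cis x] to the power [S n] is 1. *)
Lemma circle_mean_monomial n k (w : C) :
  (1 <= k <= n)%nat -> circle_mean n (fun z => Re (w * z ^ k)%C) = 0.
Proof.
  intros Hk.
  pose proof (pos_INR n) as Hn.
  assert (HkR : 1 <= INR k <= INR n).
  { split; [apply (le_INR 1) | apply le_INR]; lia. }
  set (x := 2 * PI * INR k / INR (S n)).
  assert (Hx : 0 < x < 2 * PI).
  { pose proof PI_RGT_0. unfold x; rewrite S_INR; split.
    - apply Rdiv_lt_0_compat; nra.
    - apply Rlt_div_l; nra. }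
  pose proof (cis_neq_1 x Hx) as Hne.
  assert (Hd : (cis x - 1)%C <> 0%C).
  { intros E; apply Hne. rewrite <- (Cplus_0_l 1), <- E. ring. }
  set (v := (w / (cis x - 1))%C).
  assert (T : forall p, sum_f_R0 (fun l => Re (w * cis (2 * PI * INR l / INR (S n)) ^ k)%C) p
     = Re (v * cis (INR (S p) * x))%C - Re v).
  { assert (St : forall l, Re (w * cis (2 * PI * INR l / INR (S n)) ^ k)%C
       = Re (v * cis (INR (S l) * x))%C - Re (v * cis (INR l * x))%C).
    { intros l.
      replace (cis (2 * PI * INR l / INR (S n)) ^ k)%C with (cis (INR l * x)).
      2:{ rewrite cis_pow; f_equal; unfold x; field; rewrite S_INR; lra. }
      replace (cis (INR (S l) * x)) with (cis x * cis (INR l * x))%C.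
      2:{ rewrite <- cis_plus; f_equal; rewrite S_INR; ring. }
      set (y := cis (INR l * x)).
      replace (w * y)%C with (v * (cis x * y) - v * y)%C by (unfold v; field; exact Hd).
      reflexivity. }
    induction p as [|p IH].
    - cbn [sum_f_R0]; rewrite St; do 3 f_equal.
      change (INR 0) with 0; rewrite Rmult_0_l; unfold cis; rewrite cos_0, sin_0.
      change (1, 0) with (RtoC 1); ring.
    - rewrite tech5, IH, St; ring. }
  unfold circle_mean; cbv beta; rewrite T.
  replace (INR (S n) * x) with (0 + 2 * INR k * PI).
  2:{ unfold x; field; rewrite S_INR; lra. }
  unfold cis; rewrite cos_period, sin_period, cos_0, sin_0.
  change (1, 0) with (RtoC 1); rewrite Cmult_1_r; field; rewrite S_INR; lra.
Qed.

Lemma circle_mean_poly n m (w : C) (c : nat -> C) :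
  (m < n)%nat -> circle_mean n (fun z => Re (w * (z * cpoly c m z))%C) = 0.
Proof.
  induction m as [|m IH]; intros Hm.
  - rewrite <- (circle_mean_monomial n 1 (w * c 0%nat)%C) by lia.
    apply circle_mean_ext; intros z _; rewrite cpoly_0; f_equal; simpl; ring.
  - transitivity (circle_mean n (fun z => Re (w * (z * cpoly c m z))%C
      + Re ((w * c (S m)) * z ^ S (S m))%C)).
    + apply circle_mean_ext; intros z _; rewrite cpoly_S, <- re_plus.
      f_equal; simpl; ring.
    + rewrite circle_mean_plus, IH, circle_mean_monomial by lia; ring.
Qed.

Lemma Cmod2_plus (u v : C) :
  Cmod (u + v) ^ 2 = Cmod u ^ 2 + Cmod v ^ 2 + 2 * Re (Cconj u * v)%C.
Proof.
  rewrite !Cmod2_alt; destruct u, v; simpl; ring.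
Qed.

(** Parseval's identity.  Splitting off the constant term leaves [z] times a
    polynomial; on the circle the modulus of the factor [z] is 1, and the cross
    term has mean zero. *)
Lemma circle_mean_Cmod2_poly n m (c : nat -> C) :
  (m <= n)%nat ->
  circle_mean n (fun z => Cmod (cpoly c m z) ^ 2) = sum_f_R0 (fun k => Cmod (c k) ^ 2) m.
Proof.
  revert c; induction m as [|m IH]; intros c Hm.
  - cbn [sum_f_R0]; rewrite <- (circle_mean_const n (Cmod (c 0%nat) ^ 2)).
    apply circle_mean_ext; intros z _; now rewrite cpoly_0.
  - transitivity (circle_mean n (fun z => (Cmod (c 0%nat) ^ 2
      + Cmod (cpoly (fun k => c (S k)) m z) ^ 2)
      + 2 * Re (Cconj (c 0%nat) * (z * cpoly (fun k => c (S k)) m z))%C)).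
    + apply circle_mean_ext; intros z Hz.
      now rewrite cpoly_shift, Cmod2_plus, Cmod_mult, Hz, Rmult_1_l.
    + rewrite circle_mean_plus, circle_mean_scal, circle_mean_poly by lia.
      rewrite circle_mean_plus, circle_mean_const, IH by lia.
      rewrite (decomp_sum _ (S m)) by lia; simpl pred; ring.
Qed.

(** * Coefficient energy of dominated power series *)

Lemma sum_n_pseries_poly (c : nat -> C) (z : C) (n : nat) :
  sum_n (fun k => scal (K := C_AbsRing) (V := C_NormedModule)
                    (pow_n (K := C_Ring) z k) (c k)) n = cpoly c n z.
Proof.
  apply sum_n_ext; intros k.
  assert (E : pow_n (K := C_Ring) z k = (z ^ k)%C).
  { induction k as [|k IH]; [reflexivity|]. simpl; now rewrite IH. }
  rewrite E; apply Cmult_comm.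
Qed.

Lemma is_pseries_C_iff (c : nat -> C) (z l : C) :
  is_pseries (K := C_AbsRing) (V := C_NormedModule) c z l <->
  forall eps, 0 < eps -> exists N, forall n, (N <= n)%nat -> Cmod (cpoly c n z - l)%C < eps.
Proof.
  unfold is_pseries, is_series; split.
  - intros H eps He.
    destruct (proj1 (filterlim_locally_ball_norm _ _) H (mkposreal eps He)) as [N HN]; exists N; intros n Hn.
    specialize (HN n Hn); rewrite sum_n_pseries_poly in HN; exact HN.
  - intros H; apply filterlim_locally_ball_norm.
    intros eps; destruct (H eps (cond_pos eps)) as [N HN]; exists N; intros n Hn.
    unfold ball_norm; rewrite sum_n_pseries_poly; exact (HN n Hn).
Qed.

Lemma is_pseries_terms_bounded (c : nat -> C) (z l : C) :
  is_pseries (K := C_AbsRing) (V := C_NormedModule) c z l ->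
  exists K, 0 < K /\ forall n, Cmod (c n) * Cmod z ^ n <= K.
Proof.
  intros H.
  destruct (filterlim_bounded _ (ex_intro _ l H)) as [M HM].
  assert (HM' : forall n, Cmod (cpoly c n z) <= M).
  { intros n; rewrite <- sum_n_pseries_poly; exact (HM n). }
  exists (M + M + 1).
  assert (0 <= M) by (eapply Rle_trans; [apply Cmod_ge_0 | apply (HM' 0%nat)]).
  split; [lra|]. intros n.
  rewrite <- Cmod_pow, <- Cmod_mult; destruct n as [|n].
  - specialize (HM' 0%nat); rewrite cpoly_0 in HM'; simpl.
    rewrite Cmult_1_r; lra.
  - replace (c (S n) * z ^ S n)%C with (cpoly c (S n) z + - cpoly c n z)%C
      by (rewrite cpoly_S; ring).
    eapply Rle_trans; [apply Cmod_triangle|]; rewrite Cmod_opp.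
    pose proof (HM' n); pose proof (HM' (S n)); lra.
Qed.

(** Comparison with a geometric series whose ratio is [rho] divided by a larger
    radius of convergence, so that the rate does not depend on the point of the
    circle. *)
Lemma poly_uniform_limit (F : C -> C) (c : nat -> C) (rho eps : R) :
  (forall z, Cmod z < 1 ->
     is_pseries (K := C_AbsRing) (V := C_NormedModule) c z (F z)) ->
  0 < rho < 1 -> 0 < eps ->
  exists N, forall n, (N <= n)%nat -> forall z, Cmod z = rho ->
    Cmod (cpoly c n z - F z)%C <= eps.
Proof.
  intros HF Hrho Heps.
  set (r := (1 + rho) / 2).
  assert (Hr : rho < r < 1) by (unfold r; lra).
  assert (Hmr : Cmod (RtoC r) = r) by (rewrite Cmod_R; apply Rabs_pos_eq; lra).
  destruct (is_pseries_terms_bounded c r (F r)) as [K [HK Hc]].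
  { apply HF; rewrite Hmr; lra. }
  rewrite Hmr in Hc.
  set (q := rho / r).
  assert (Hq : 0 < q < 1).
  { unfold q; split; [apply Rdiv_lt_0_compat; lra | apply Rlt_div_l; lra]. }
  assert (Hterm : forall k z, Cmod z = rho -> Cmod (c k * z ^ k)%C <= K * q ^ k).
  { intros k z Hz; rewrite Cmod_mult, Cmod_pow, Hz.
    replace (rho ^ k) with (r ^ k * q ^ k)
      by (rewrite <- Rpow_mult_distr; f_equal; unfold q; field; lra).
    rewrite <- Rmult_assoc; apply Rmult_le_compat_r; [apply pow_le; lra | apply Hc]. }
  assert (Hdiff : forall n d z, Cmod z = rho ->
    Cmod (cpoly c (n + d) z - cpoly c n z)%C <= K / (1 - q) * (q ^ n - q ^ (n + d))).
  { intros n d z Hz; induction d as [|d IH].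
    - rewrite Nat.add_0_r; unfold Cminus; rewrite Cplus_opp_r, Cmod_0; lra.
    - rewrite Nat.add_succ_r, cpoly_S.
      replace (cpoly c (n + d) z + c (S (n + d)) * z ^ S (n + d) - cpoly c n z)%C
        with ((cpoly c (n + d) z - cpoly c n z) + c (S (n + d)) * z ^ S (n + d))%C by ring.
      eapply Rle_trans; [apply Cmod_triangle|].
      pose proof (Hterm (S (n + d)) z Hz) as Ht.
      assert (Hp : 0 < q ^ (n + d)) by (apply pow_lt; lra).
      replace (K / (1 - q) * (q ^ n - q ^ S (n + d)))
        with (K / (1 - q) * (q ^ n - q ^ (n + d)) + K * q ^ (n + d))
        by (simpl; field; lra).
      assert (K * q ^ S (n + d) <= K * q ^ (n + d)).
      { apply Rmult_le_compat_l; [lra|]; simpl; nra. }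
      lra. }
  assert (HC : 0 < K / (1 - q)) by (apply Rdiv_lt_0_compat; lra).
  destruct (pow_lt_1_zero q (Rabs_def1 _ _ (proj2 Hq) ltac:(lra))
              (eps / 2 / (K / (1 - q)))) as [N HN].
  { apply Rdiv_lt_0_compat; lra. }
  exists N; intros n Hn z Hz.
  destruct (proj1 (is_pseries_C_iff c z (F z)) (HF z ltac:(lra)) (eps / 2) ltac:(lra))
    as [P HP].
  specialize (HP (n + P)%nat ltac:(lia)).
  specialize (HN n Hn); specialize (Hdiff n P z Hz).
  rewrite Rabs_pos_eq in HN by (apply pow_le; lra).
  assert (Hpow : 0 < q ^ (n + P)) by (apply pow_lt; lra).
  apply Rlt_div_r in HN; [|lra].
  replace (cpoly c n z - F z)%C
    with (- (cpoly c (n + P) z - cpoly c n z) + (cpoly c (n + P) z - F z))%C by ring.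
  eapply Rle_trans; [apply Cmod_triangle|]; rewrite Cmod_opp; nra.
Qed.

Lemma sum_le_of_dilations (u : nat -> R) (p : nat) (B : R) :
  (forall rho, 0 < rho < 1 -> sum_f_R0 (fun k => u k * (rho ^ k) ^ 2) p <= B) ->
  sum_f_R0 u p <= B.
Proof.
  intros H.
  set (rho := fun n : nat => 1 - / (INR n + 2)).
  assert (Hrho : forall n, 0 < rho n < 1).
  { intros n; unfold rho; pose proof (pos_INR n).
    assert (0 < / (INR n + 2) < 1).
    { split; [apply Rinv_0_lt_compat; lra|].
      rewrite <- Rinv_1; apply Rinv_lt_contravar; lra. }
    lra. }
  assert (Lrho : is_lim_seq rho 1).
  { unfold rho; replace (Finite 1) with (Finite (1 - 0)) by (f_equal; ring).
    apply is_lim_seq_minus'; [apply is_lim_seq_const|].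
    apply (is_lim_seq_inv _ p_infty); [|discriminate].
    eapply is_lim_seq_plus; [apply is_lim_seq_INR | apply is_lim_seq_const | reflexivity]. }
  assert (Lpow : forall k, is_lim_seq (fun n => rho n ^ k) 1).
  { induction k as [|k IH]; [apply is_lim_seq_const|].
    replace (Finite 1) with (Finite (1 * 1)) by (f_equal; ring).
    exact (is_lim_seq_mult' _ _ _ _ Lrho IH). }
  assert (Lterm : forall k, is_lim_seq (fun n => u k * (rho n ^ k) ^ 2) (u k)).
  { intros k; replace (Finite (u k)) with (Finite (u k * (1 * (1 * 1)))) by (f_equal; ring).
    apply is_lim_seq_mult'; [apply is_lim_seq_const|].
    apply is_lim_seq_mult'; [apply Lpow|].
    apply is_lim_seq_mult'; [apply Lpow | apply is_lim_seq_const]. }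
  assert (Lsum : is_lim_seq (fun n => sum_f_R0 (fun k => u k * (rho n ^ k) ^ 2) p)
                            (sum_f_R0 u p)).
  { clear H; induction p as [|p IH]; [apply Lterm|].
    exact (is_lim_seq_plus' _ _ _ _ IH (Lterm (S p))). }
  exact (is_lim_seq_le _ _ _ _ (fun n => H _ (Hrho n)) Lsum (is_lim_seq_const B)).
Qed.

Lemma cpoly_dilate (c : nat -> C) (n : nat) (rho : R) (z : C) :
  cpoly c n (rho * z) = cpoly (fun k => c k * RtoC rho ^ k)%C n z.
Proof.
  apply sum_n_ext; intros k; rewrite Cpow_mult_l; apply Cmult_assoc.
Qed.

Lemma Cmod2_dilate (c : nat -> C) (rho : R) (k : nat) :
  0 < rho -> Cmod (c k * RtoC rho ^ k)%C ^ 2 = Cmod (c k) ^ 2 * (rho ^ k) ^ 2.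
Proof.
  intros H; rewrite Cmod_mult, Cmod_pow, Cmod_R, Rabs_pos_eq by lra.
  apply Rpow_mult_distr.
Qed.

Lemma sum_f_R0_mono (u : nat -> R) (p q : nat) :
  (forall k, 0 <= u k) -> (p <= q)%nat -> sum_f_R0 u p <= sum_f_R0 u q.
Proof.
  intros Hu; induction 1 as [|q _ IH]; [apply Rle_refl|].
  rewrite tech5; specialize (Hu (S q)); lra.
Qed.

(** On a circle of radius [rho < 1] the function is uniformly close to a Taylor
    polynomial, so Parseval's identity for polynomials applies to both sides; then
    the error and [1 - rho] tend to 0. *)
Lemma coef_energy_le (F : C -> C) (c x : nat -> C) (m : nat) :
  (forall z, Cmod z < 1 ->
     is_pseries (K := C_AbsRing) (V := C_NormedModule) c z (F z)) ->
  (forall z, Cmod z < 1 -> Cmod (F z) <= Cmod (cpoly x m z)) ->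
  forall p, sum_f_R0 (fun k => Cmod (c k) ^ 2) p <= sum_f_R0 (fun k => Cmod (x k) ^ 2) m.
Proof.
  intros HF Hdom p; apply sum_le_of_dilations; intros rho Hrho.
  set (B := sum_f_R0 (fun k => Cmod (x k) ^ 2) m).
  assert (HB : 0 <= B) by (apply cond_pos_sum; intros; apply pow2_ge_0).
  apply le_epsilon; intros eps Heps.
  (* For [e <= 1] the total error [e * B + e + e ^ 2] is at most [e * (B + 2)]. *)
  set (e := Rmin 1 (eps / (B + 2))).
  assert (He0 : 0 < e) by (apply Rmin_pos; [lra | apply Rdiv_lt_0_compat; lra]).
  assert (He1 : e <= 1) by apply Rmin_l.
  assert (He2 : e * (B + 2) <= eps).
  { apply (Rle_div_r e); [lra | apply Rmin_r]. }
  destruct (poly_uniform_limit F c rho e HF Hrho He0) as [N HN].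
  set (n := (N + p + m)%nat).
  assert (Hpt : forall z, Cmod z = 1 ->
     Cmod (cpoly (fun k => c k * RtoC rho ^ k)%C n z) ^ 2
     <= (1 + e) * Cmod (cpoly (fun k => x k * RtoC rho ^ k)%C m z) ^ 2 + (e + e ^ 2)).
  { intros z Hz; rewrite <- !cpoly_dilate.
    assert (Hm : Cmod (rho * z)%C = rho).
    { rewrite Cmod_mult, Hz, Cmod_R, Rabs_pos_eq; lra. }
    set (w := (rho * z)%C) in *.
    assert (H1 : Cmod (cpoly c n w) <= Cmod (cpoly x m w) + e).
    { replace (cpoly c n w) with (F w + (cpoly c n w - F w))%C by ring.
      eapply Rle_trans; [apply Cmod_triangle|].
      apply Rplus_le_compat; [apply Hdom; lra | apply HN; [unfold n; lia | exact Hm]]. }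
    pose proof (Cmod_ge_0 (cpoly c n w)); pose proof (Cmod_ge_0 (cpoly x m w)).
    set (g := Cmod (cpoly x m w)) in *; set (h := Cmod (cpoly c n w)) in *.
    assert (h ^ 2 <= (g + e) ^ 2) by (apply pow_incr; lra).
    pose proof (Rmult_le_pos e ((g - 1) ^ 2) (Rlt_le _ _ He0) (pow2_ge_0 _)).
    lra. }
  apply (circle_mean_le n) in Hpt.
  rewrite circle_mean_plus, circle_mean_scal, circle_mean_const in Hpt.
  rewrite !circle_mean_Cmod2_poly in Hpt by (unfold n; lia).
  assert (HL : sum_f_R0 (fun k => Cmod (c k) ^ 2 * (rho ^ k) ^ 2) p
               <= sum_f_R0 (fun k => Cmod (c k * RtoC rho ^ k)%C ^ 2) n).
  { eapply Rle_trans; [|apply sum_f_R0_mono with (p := p)].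
    - apply Req_le, sum_eq; intros; now rewrite Cmod2_dilate.
    - intros; apply pow2_ge_0.
    - unfold n; lia. }
  assert (HR : sum_f_R0 (fun k => Cmod (x k * RtoC rho ^ k)%C ^ 2) m <= B).
  { apply sum_Rle; intros k _; rewrite Cmod2_dilate by lra.
    rewrite <- (Rmult_1_r (Cmod (x k) ^ 2)) at 2.
    apply Rmult_le_compat_l; [apply pow2_ge_0|].
    rewrite <- (pow1 2); apply pow_incr; split; [apply pow_le; lra|].
    rewrite <- (pow1 k); apply pow_incr; lra. }
  nra.
Qed.

(** * The Toeplitz contraction of a bounded analytic function *)

Definition conv (a x : nat -> C) (m j : nat) : C :=
  sum_n (fun k => x k * (if (k <=? j)%nat then a (j - k)%nat else 0))%C m.

Lemma PS_incr_n_eq (a : nat -> C) (k j : nat) :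
  PS_incr_n (K := C_AbsRing) (V := C_NormedModule) a k j
  = (if (k <=? j)%nat then a (j - k)%nat else RtoC 0).
Proof.
  revert j; induction k as [|k IH]; intros j; simpl; [now rewrite Nat.sub_0_r|].
  destruct j as [|j]; [reflexivity | exact (IH j)].
Qed.

Lemma is_pseries_conv (a x : nat -> C) (m : nat) (z l : C) :
  is_pseries (K := C_AbsRing) (V := C_NormedModule) a z l ->
  is_pseries (K := C_AbsRing) (V := C_NormedModule) (conv a x m) z (l * cpoly x m z)%C.
Proof.
  intros H.
  assert (T : forall k, is_pseries (K := C_AbsRing) (V := C_NormedModule)
     (fun j => x k * (if (k <=? j)%nat then a (j - k)%nat else 0))%C z (x k * (z ^ k * l))%C).
  { intros k.
    apply (is_pseries_incr_n _ k) in H.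
    apply (is_pseries_scal (x k)) in H; [|apply Cmult_comm].
    assert (E : pow_n (K := C_Ring) z k = (z ^ k)%C).
    { clear; induction k as [|k IH]; [reflexivity|]. simpl; now rewrite IH. }
    change (is_pseries (K := C_AbsRing) (V := C_NormedModule)
       (PS_scal (x k) (PS_incr_n (K := C_AbsRing) (V := C_NormedModule) a k)) z
       (x k * (pow_n (K := C_Ring) z k * l))%C) in H.
    rewrite E in H.
    refine (is_pseries_ext _ _ _ _ _ H).
    intros j; unfold PS_scal; now rewrite PS_incr_n_eq. }
  induction m as [|m IH].
  - replace (l * cpoly x 0 z)%C with (x 0%nat * (z ^ 0 * l))%C
      by (rewrite cpoly_0; simpl; ring).
    refine (is_pseries_ext _ _ _ _ _ (T 0%nat)).
    intros j; unfold conv; now rewrite sum_O.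
  - replace (l * cpoly x (S m) z)%C with (l * cpoly x m z + x (S m) * (z ^ S m * l))%C
      by (rewrite cpoly_S; ring).
    refine (is_pseries_ext _ _ _ _ _ (is_pseries_plus _ _ _ _ _ IH (T (S m)))).
    intros j; unfold conv; symmetry; apply sum_n_C_S.
Qed.

(** [conv a x m] lists the coefficients of [f] times a polynomial, a product
    dominated on the disk by the polynomial. *)
Lemma toeplitz_contraction (f : C -> C) (a : nat -> C) :
  bounded_analytic f a -> forall x m p,
  sum_f_R0 (fun j => Cmod (conv a x m j) ^ 2) p <= sum_f_R0 (fun k => Cmod (x k) ^ 2) m.
Proof.
  intros H x m p; apply (coef_energy_le (fun z => f z * cpoly x m z)%C).
  - intros z Hz; apply is_pseries_conv, H, Hz.
  - intros z Hz; rewrite Cmod_mult; destruct (H z Hz) as [_ Hf].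
    pose proof (Cmod_ge_0 (cpoly x m z)); pose proof (Cmod_ge_0 (f z)); nra.
Qed.

(** The test polynomials have a constant term [w], a gap of length [n], and then
    the coefficients [y].  The gap makes the first [n + 1] coefficients of the
    product equal to those of [f] up to the phase [w], whatever [y] is. *)
Definition gap_vector (w : C) (n : nat) (y : nat -> C) (k : nat) : C :=
  match k with
  | 0%nat => w
  | S k' => if (k' <? n)%nat then 0%C else y (k' - n)%nat
  end.

Lemma gap_vector_low w n y k : (1 <= k <= n)%nat -> gap_vector w n y k = 0%C.
Proof.
  destruct k as [|k]; simpl; [lia|]; intros Hk.
  now rewrite (proj2 (Nat.ltb_lt k n)) by lia.
Qed.

Lemma gap_vector_high w n y i : gap_vector w n y (S n + i) = y i.
Proof.
  simpl; rewrite (proj2 (Nat.ltb_ge (n + i) n)) by lia; f_equal; lia.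
Qed.

Lemma sum_n_gap (G : AbelianMonoid) (u : nat -> G) (n d : nat) :
  (forall k, (1 <= k <= n)%nat -> u k = zero) ->
  sum_n u (S n + d) = plus (u 0%nat) (sum_n (fun i => u (S n + i)%nat) d).
Proof.
  intros Hu.
  assert (H0 : sum_n u n = u 0%nat).
  { induction n as [|n IH]; [apply sum_O|].
    rewrite sum_Sn, IH, (Hu (S n)) by (intros; try apply Hu; lia); apply plus_zero_r. }
  induction d as [|d IH].
  - rewrite Nat.add_0_r, sum_Sn, sum_O, Nat.add_0_r, H0; reflexivity.
  - rewrite Nat.add_succ_r, !sum_Sn, IH, <- plus_assoc, Nat.add_succ_r; reflexivity.
Qed.

Lemma conv_gap_low a w n y d j : (j <= n)%nat ->
  conv a (gap_vector w n y) (S n + d) j = (w * a j)%C.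
Proof.
  intros Hj; unfold conv; rewrite sum_n_gap.
  - rewrite (sum_n_ext _ (fun _ => zero)).
    + unfold sum_n; rewrite sum_n_m_const_zero, plus_zero_r; simpl.
      now rewrite Nat.sub_0_r.
    + intros i; rewrite (proj2 (Nat.leb_gt (S n + i) j)) by lia; apply Cmult_0_r.
  - intros k Hk; rewrite gap_vector_low by lia; apply Cmult_0_l.
Qed.

Lemma conv_gap_next a w n y d :
  conv a (gap_vector w n y) (S n + d) (S n) = (w * a (S n) + y 0%nat * a 0%nat)%C.
Proof.
  unfold conv; rewrite sum_n_gap.
  - change plus with Cplus; f_equal.
    induction d as [|d IH].
    + rewrite sum_O, gap_vector_high, Nat.add_0_r, Nat.leb_refl, Nat.sub_diag; reflexivity.
    + rewrite sum_n_C_S, IH, (proj2 (Nat.leb_gt (S n + S d) (S n))) by lia.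
      rewrite Cmult_0_r; apply Cplus_0_r.
  - intros k Hk; rewrite gap_vector_low by lia; apply Cmult_0_l.
Qed.

Lemma conv_gap_last a w n y d :
  conv a (gap_vector w n y) (S n + d) (S n + d)
  = (w * a (S n + d)%nat + sum_n (fun i => y i * a (d - i)%nat) d)%C.
Proof.
  unfold conv; rewrite sum_n_gap.
  - change plus with Cplus; f_equal.
    apply sum_n_ext_loc; intros i Hi.
    rewrite gap_vector_high, (proj2 (Nat.leb_le (S n + i) (S n + d))) by lia.
    do 2 f_equal; lia.
  - intros k Hk; rewrite gap_vector_low by lia; apply Cmult_0_l.
Qed.

Lemma gap_vector_energy w n y d : Cmod w = 1 ->
  sum_f_R0 (fun k => Cmod (gap_vector w n y k) ^ 2) (S n + d)
  = 1 + sum_f_R0 (fun i => Cmod (y i) ^ 2) d.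
Proof.
  intros Hw; rewrite <- !sum_n_Reals, sum_n_gap.
  - change plus with Rplus; f_equal; [simpl; rewrite Hw; ring|].
    apply sum_n_ext; intros i; now rewrite gap_vector_high.
  - intros k Hk; rewrite gap_vector_low, Cmod_0 by lia; simpl; apply Rmult_0_l.
Qed.

(** The rows up to [n] contribute the energy of the first coefficients.  The last row
    pairs [y] with the reversed coefficients, so that taking [y] from their
    conjugates produces squares there. *)
Lemma toeplitz_gap (f : C -> C) (a : nat -> C) w n y d :
  bounded_analytic f a -> Cmod w = 1 ->
  sum_f_R0 (fun j => Cmod (a j) ^ 2) n
  + Cmod (w * a (S n + d)%nat + sum_n (fun i => y i * a (d - i)%nat) d)%C ^ 2
  <= 1 + sum_f_R0 (fun i => Cmod (y i) ^ 2) d.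
Proof.
  intros H Hw; rewrite <- (gap_vector_energy w n) by exact Hw.
  eapply Rle_trans; [|apply (toeplitz_contraction f a H _ _ (S n + d))].
  rewrite <- conv_gap_last, (tech5 _ (n + d)).
  apply Rplus_le_compat_r.
  eapply Rle_trans; [|apply sum_f_R0_mono with (p := n); [intros; apply pow2_ge_0 | lia]].
  apply sum_Rle; intros j Hj; rewrite conv_gap_low, Cmod_mult, Hw, Rmult_1_l by exact Hj.
  apply Rle_refl.
Qed.

(** As [toeplitz_gap], keeping also the row just after the gap. *)
Lemma toeplitz_gap_next (f : C -> C) (a : nat -> C) w n y d :
  bounded_analytic f a -> Cmod w = 1 ->
  sum_f_R0 (fun j => Cmod (a j) ^ 2) n
  + Cmod (w * a (S n) + y 0%nat * a 0%nat)%C ^ 2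
  + Cmod (w * a (S n + S d)%nat + sum_n (fun i => y i * a (S d - i)%nat) (S d))%C ^ 2
  <= 1 + sum_f_R0 (fun i => Cmod (y i) ^ 2) (S d).
Proof.
  intros H Hw; rewrite <- (gap_vector_energy w n) by exact Hw.
  eapply Rle_trans; [|apply (toeplitz_contraction f a H _ _ (S n + S d))].
  rewrite <- conv_gap_last, (tech5 _ (n + S d)).
  apply Rplus_le_compat_r.
  rewrite <- (conv_gap_next a w n y (S d)).
  eapply Rle_trans; [|apply sum_f_R0_mono with (p := S n); [intros; apply pow2_ge_0 | lia]].
  rewrite tech5; apply Rplus_le_compat_r.
  apply sum_Rle; intros j Hj; rewrite conv_gap_low, Cmod_mult, Hw, Rmult_1_l by exact Hj.
  apply Rle_refl.
Qed.

(** * Coefficient inequalities *)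

Lemma sum_f_R0_rev (u : nat -> R) (n : nat) :
  sum_f_R0 (fun i => u (n - i)%nat) n = sum_f_R0 u n.
Proof.
  induction n as [|n IH]; [reflexivity|].
  rewrite (decomp_sum _ (S n)), tech5 by lia; cbn [pred Nat.sub].
  rewrite IH; ring.
Qed.

Lemma sum_n_conj_mult (z : nat -> C) (n : nat) :
  sum_n (fun i => Cconj (z i) * z i)%C n = RtoC (sum_f_R0 (fun i => Cmod (z i) ^ 2) n).
Proof.
  induction n as [|n IH].
  - rewrite sum_O; cbn [sum_f_R0]; rewrite Cmod2_conj; apply Cmult_comm.
  - rewrite sum_n_C_S, IH, tech5, RtoC_plus, Cmod2_conj; f_equal; apply Cmult_comm.
Qed.

Lemma unimodular_phase (z : C) : exists w, Cmod w = 1 /\ (w * z)%C = RtoC (Cmod z).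
Proof.
  destruct (Ceq_dec z 0) as [->|Hz].
  - exists 1%C; rewrite Cmod_1, Cmod_0; split; [reflexivity | apply Cmult_0_r].
  - pose proof (proj1 (Cmod_gt_0 z) Hz) as Hm.
    assert (Hm' : RtoC (Cmod z) <> 0%C) by (intros E; injection E; lra).
    exists (Cconj z / RtoC (Cmod z))%C; split.
    + rewrite Cmod_div, Cmod_conj, Cmod_R, Rabs_pos_eq by (try exact Hm'; lra); field; lra.
    + replace (Cconj z / Cmod z * z)%C with (z * Cconj z / Cmod z)%C by (field; exact Hm').
      rewrite <- Cmod2_conj, <- RtoC_div; [f_equal; field; lra | lra].
Qed.

Definition energy (a : nat -> C) (n : nat) : R := sum_f_R0 (fun k => Cmod (a k) ^ 2) n.

Lemma energy_S a n : energy a (S n) = energy a n + Cmod (a (S n)) ^ 2.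
Proof. exact (tech5 _ n). Qed.

Lemma energy_0 a : energy a 0 = Cmod (a 0%nat) ^ 2.
Proof. reflexivity. Qed.

Lemma energy_nonneg a n : 0 <= energy a n.
Proof. apply cond_pos_sum; intros; apply pow2_ge_0. Qed.

Lemma sum_n_conj_rev (a : nat -> C) (n : nat) :
  sum_n (fun i => Cconj (a (n - i)%nat) * a (n - i)%nat)%C n = RtoC (energy a n).
Proof.
  rewrite sum_n_conj_mult.
  now rewrite (sum_f_R0_rev (fun k => Cmod (a k) ^ 2) n).
Qed.

(** The tail of the test vector consists of the conjugates of [a n], ..., [a 0],
    which makes the last row equal to the modulus of the coefficient plus the energy.
    With [E] for the energy and [X] for the modulus, the contraction reads
    [E + (X + E) ^ 2 <= 1 + E]. *)
Lemma odd_coef_bound (f : C -> C) (a : nat -> C) (n : nat) :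
  bounded_analytic f a -> Cmod (a (2 * n + 1)%nat) <= 1 - energy a n.
Proof.
  intros H.
  replace (2 * n + 1)%nat with (S n + n)%nat by lia.
  destruct (unimodular_phase (a (S n + n)%nat)) as [w [Hw Hp]].
  pose proof (toeplitz_gap f a w n (fun i => Cconj (a (n - i)%nat)) n H Hw) as T.
  cbv beta in T.
  rewrite Hp, sum_n_conj_rev, <- RtoC_plus, Cmod_R in T.
  rewrite (sum_eq (fun i => Cmod (Cconj (a (n - i)%nat)) ^ 2)
                  (fun i => Cmod (a (n - i)%nat) ^ 2)) in T
    by (intros; now rewrite Cmod_conj).
  rewrite (sum_f_R0_rev (fun k => Cmod (a k) ^ 2) n) in T; fold (energy a n) in T.
  rewrite pow2_abs in T.
  pose proof (energy_nonneg a n); pose proof (Cmod_ge_0 (a (S n + n)%nat)); nra.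
Qed.

(** As in the odd case, but the middle coefficient [a (S n)] now meets itself in
    the last row.  Giving it the weight [c = 1 / (1 + A 0)] makes the row after the
    gap at least [c * A (S n)], because [1 - c * A 0 = c]; this cancels the cost of
    the weight in the norm of the test vector. *)
Lemma even_coef_bound (f : C -> C) (a : nat -> C) (n : nat) :
  bounded_analytic f a ->
  Cmod (a (2 * n + 2)%nat)
  <= 1 - energy a n - Cmod (a (S n)) ^ 2 / (1 + Cmod (a 0%nat)).
Proof.
  intros H.
  replace (2 * n + 2)%nat with (S n + S n)%nat by lia.
  destruct (unimodular_phase (a (S n + S n)%nat)) as [w [Hw Hp]].
  pose proof (Cmod_ge_0 (a 0%nat)) as H0.
  pose proof (Cmod_ge_0 (a (S n))) as H1.
  set (c := / (1 + Cmod (a 0%nat))).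
  assert (Hc : 0 < c) by (apply Rinv_0_lt_compat; lra).
  assert (Hc1 : c * (1 + Cmod (a 0%nat)) = 1) by (unfold c; field; lra).
  set (y := fun i => match i with
                     | 0%nat => (RtoC c * Cconj (a (S n)))%C
                     | S i' => Cconj (a (n - i')%nat)
                     end).
  pose proof (toeplitz_gap_next f a w n y n H Hw) as T.
  assert (Ey : sum_f_R0 (fun i => Cmod (y i) ^ 2) (S n)
               = c ^ 2 * Cmod (a (S n)) ^ 2 + energy a n).
  { rewrite (decomp_sum _ (S n)) by lia; cbn [pred y].
    rewrite Cmod_mult, Cmod_conj, Cmod_R, Rabs_pos_eq, Rpow_mult_distr by lra; f_equal.
    unfold energy; rewrite <- (sum_f_R0_rev (fun k => Cmod (a k) ^ 2) n).
    apply sum_eq; intros; now rewrite Cmod_conj. }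
  assert (Ry : sum_n (fun i => y i * a (S n - i)%nat)%C (S n)
               = RtoC (c * Cmod (a (S n)) ^ 2 + energy a n)).
  { rewrite (sum_n_gap _ _ 0 n) by lia.
    rewrite RtoC_plus, RtoC_mult, Cmod2_conj, <- sum_n_conj_rev.
    cbn [y Nat.sub Nat.add]; change plus with Cplus; f_equal; ring. }
  rewrite Ey, Hp, Ry, <- RtoC_plus, Cmod_R, pow2_abs in T.
  fold (energy a n) in T.
  assert (Hn : c * Cmod (a (S n)) <= Cmod (w * a (S n) + y 0%nat * a 0%nat)%C).
  { assert (E : Cmod (w * a (S n))%C = Cmod (a (S n))) by (rewrite Cmod_mult, Hw; ring).
    assert (E' : Cmod (y 0%nat * a 0%nat)%C = c * Cmod (a (S n)) * Cmod (a 0%nat)).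
    { cbn [y]; rewrite !Cmod_mult, Cmod_conj, Cmod_R, Rabs_pos_eq by lra; ring. }
    replace (w * a (S n))%C
      with ((w * a (S n) + y 0%nat * a 0%nat) + - (y 0%nat * a 0%nat))%C in E by ring.
    pose proof (Cmod_triangle (w * a (S n) + y 0%nat * a 0%nat) (- (y 0%nat * a 0%nat)))
      as Ht.
    rewrite E, Cmod_opp, E' in Ht; nra. }
  assert (Hn2 : c ^ 2 * Cmod (a (S n)) ^ 2
                <= Cmod (w * a (S n) + y 0%nat * a 0%nat)%C ^ 2).
  { rewrite <- Rpow_mult_distr; apply pow_incr; split; [nra | exact Hn]. }
  pose proof (energy_nonneg a n); pose proof (Cmod_ge_0 (a (S n + S n)%nat)).
  pose proof (Rmult_le_pos c _ (Rlt_le _ _ Hc) (pow2_ge_0 (Cmod (a (S n))))).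
  change (Cmod (a (S n)) ^ 2 / (1 + Cmod (a 0%nat))) with (Cmod (a (S n)) ^ 2 * c).
  nra.
Qed.

Lemma energy_le_1 (f : C -> C) (a : nat -> C) (n : nat) :
  bounded_analytic f a -> energy a n <= 1.
Proof.
  intros H; pose proof (odd_coef_bound f a n H); pose proof (Cmod_ge_0 (a (2 * n + 1)%nat)); lra.
Qed.

Lemma coef_le_1 (f : C -> C) (a : nat -> C) (n : nat) :
  bounded_analytic f a -> Cmod (a n) <= 1.
Proof.
  intros H; pose proof (energy_le_1 f a n H) as E; pose proof (Cmod_ge_0 (a n)).
  assert (Cmod (a n) ^ 2 <= energy a n).
  { destruct n as [|n]; [apply Rle_refl|].
    rewrite energy_S; pose proof (energy_nonneg a n); lra. }
  nra.
Qed.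

(** The test vector has one entry after the gap, proportional to
    [a (S n)] times the conjugate of [a 0]; the factor [1 / (1 - A 0 ^ 2)] is the
    maximizer of the resulting quadratic expression.  When [A 0 = 1] there is no
    energy left for the other coefficients. *)
Lemma coef_sq_bound (f : C -> C) (a : nat -> C) (n : nat) :
  bounded_analytic f a ->
  Cmod (a (S n)) ^ 2 <= (1 - Cmod (a 0%nat) ^ 2) * (1 - energy a n).
Proof.
  intros H.
  pose proof (coef_le_1 f a 0 H) as H1; pose proof (Cmod_ge_0 (a 0%nat)) as H0.
  set (b := (1 - Cmod (a 0%nat) ^ 2)).
  assert (Hb : b = 1 - Cmod (a 0%nat) ^ 2) by reflexivity.
  destruct (Rle_lt_or_eq_dec _ _ H1) as [Hlt|Heq].
  - assert (Hb0 : 0 < b) by nra.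
    pose proof (toeplitz_gap f a 1%C n
      (fun _ => (RtoC (/ b) * (a (S n) * Cconj (a 0%nat)))%C) 0 H Cmod_1) as T.
    cbn [sum_f_R0] in T; rewrite sum_O, Nat.add_0_r in T; cbn [Nat.sub] in T.
    replace (1 * a (S n) + RtoC (/ b) * (a (S n) * Cconj (a 0%nat)) * a 0%nat)%C
      with (a (S n) * (1 + RtoC (/ b) * (a 0%nat * Cconj (a 0%nat))))%C in T by ring.
    rewrite <- Cmod2_conj, <- RtoC_mult, <- RtoC_plus, !Cmod_mult, Cmod_conj, !Cmod_R in T.
    replace (1 + / b * Cmod (a 0%nat) ^ 2) with (/ b) in T by (rewrite Hb; field; lra).
    assert (Hi : 0 < / b) by (apply Rinv_0_lt_compat; lra).
    assert (Hbi : b * / b = 1) by (field; lra).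
    rewrite !Rabs_pos_eq in T by lra.
    fold (energy a n) in T.
    assert (E : Cmod (a (S n)) ^ 2 * / b <= 1 - energy a n).
    { replace (Cmod (a (S n)) ^ 2 * / b)
        with ((Cmod (a (S n)) * / b) ^ 2
              - (/ b * (Cmod (a (S n)) * Cmod (a 0%nat))) ^ 2); [lra|].
      transitivity (Cmod (a (S n)) ^ 2 * / b * (/ b * (1 - Cmod (a 0%nat) ^ 2))); [ring|].
      rewrite <- Hb, (Rmult_comm (/ b) b), Hbi; ring. }
    apply (Rmult_le_compat_l b) in E; [|lra].
    replace (b * (Cmod (a (S n)) ^ 2 * / b)) with (Cmod (a (S n)) ^ 2) in E by (field; lra).
    exact E.
  - pose proof (energy_le_1 f a (S n) H) as E; rewrite energy_S in E.
    assert (E0 : 1 <= energy a n).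
    { replace 1 with (energy a 0) by (rewrite energy_0, Heq; ring).
      apply sum_f_R0_mono; [intros; apply pow2_ge_0 | lia]. }
    assert (b = 0) by (rewrite Hb, Heq; ring).
    nra.
Qed.

(** Equality holds for the disk automorphisms. *)
Lemma energy_upper_bound (f : C -> C) (a : nat -> C) (n : nat) :
  bounded_analytic f a ->
  energy a n <= 1 - (1 - Cmod (a 0%nat) ^ 2) * (Cmod (a 0%nat) ^ 2) ^ n.
Proof.
  intros H; induction n as [|n IH].
  - rewrite energy_0; simpl; lra.
  - rewrite energy_S; pose proof (coef_sq_bound f a n H) as E.
    pose proof (pow2_ge_0 (Cmod (a 0%nat))).
    cbn [pow] in *; nra.
Qed.

(** * Sharp bounds for the Bohr sum and for the area *)

Lemma Series_le_of_partial_sums (u : nat -> R) (B : R) :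
  ex_series u -> (forall n, sum_f_R0 u n <= B) -> Series u <= B.
Proof.
  intros Hu HB.
  refine (is_lim_seq_le (sum_n u) (fun _ => B) (Series u) B _ _ (is_lim_seq_const B)).
  - intros n; rewrite sum_n_Reals; apply HB.
  - exact (Series_correct u Hu).
Qed.

Lemma is_lim_seq_sum (u : nat -> R) :
  ex_series u -> is_lim_seq (sum_f_R0 u) (Series u).
Proof.
  intros Hu; apply (is_lim_seq_ext (sum_n u)); [apply sum_n_Reals|].
  exact (Series_correct u Hu).
Qed.

Lemma ex_series_nonneg_le (u v : nat -> R) :
  (forall n, 0 <= u n <= v n) -> ex_series v -> ex_series u.
Proof.
  intros H; apply (ex_series_le (K := R_AbsRing) (V := R_CompleteNormedModule)).
  intros n; change (norm (u n)) with (Rabs (u n)); rewrite Rabs_pos_eq; apply H.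
Qed.

Lemma ex_series_INR_pow (q : R) : 0 <= q < 1 -> ex_series (fun n => INR n * q ^ n).
Proof.
  intros Hq.
  set (s := (1 + q) / 2).
  assert (Hs : 0 < s < 1 /\ q < s) by (unfold s; lra).
  set (t := q / s).
  assert (Ht : 0 <= t < 1).
  { unfold t; split; [apply Rdiv_le_0_compat; lra | apply Rlt_div_l; lra]. }
  (* Bernoulli: [1 + n (1/s - 1) <= s ^ -n] absorbs the factor [n]. *)
  assert (Hd : 0 < / s - 1).
  { enough (1 < / s) by lra; rewrite <- Rinv_1; apply Rinv_lt_contravar; lra. }
  apply (ex_series_nonneg_le _ (fun n => / (/ s - 1) * t ^ n)).
  - intros n.
    assert (Hp : 0 <= q ^ n) by (apply pow_le; lra).
    split; [apply Rmult_le_pos; [apply pos_INR | exact Hp]|].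
    assert (B : INR n * (/ s - 1) <= (/ s) ^ n).
    { pose proof (poly n (/ s - 1) Hd) as P.
      replace (1 + (/ s - 1)) with (/ s) in P by ring; lra. }
    replace (t ^ n) with ((/ s) ^ n * q ^ n)
      by (rewrite <- Rpow_mult_distr; f_equal; unfold t; field; lra).
    apply (Rmult_le_reg_l (/ s - 1)); [exact Hd|].
    rewrite <- (Rmult_assoc (/ s - 1) (/ (/ s - 1))), Rinv_r, Rmult_1_l by lra; nra.
  - apply (ex_series_scal_l (K := R_AbsRing) (V := R_NormedModule)).
    apply ex_series_geom; rewrite Rabs_pos_eq; lra.
Qed.

(** Shifting the index shows that the sum [S] satisfies
    [S = q * (S + 1 / (1 - q))]. *)
Lemma Series_INR_pow (q : R) : 0 <= q < 1 ->
  Series (fun n => INR n * q ^ n) = q / (1 - q) ^ 2.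
Proof.
  intros Hq.
  assert (Ha : Rabs q < 1) by (rewrite Rabs_pos_eq; lra).
  pose proof (ex_series_INR_pow q Hq) as Hex.
  pose proof (ex_series_geom q Ha) as Hg.
  assert (E : Series (fun n => INR n * q ^ n)
              = q * (Series (fun n => INR n * q ^ n) + / (1 - q))).
  { rewrite Series_incr_1 at 1 by exact Hex.
    rewrite <- (Series_geom q Ha), <- Series_plus, <- Series_scal_l by assumption.
    simpl INR at 1; rewrite Rmult_0_l, Rplus_0_l.
    apply Series_ext; intros n; rewrite S_INR; simpl; ring. }
  apply (Rmult_eq_reg_r (1 - q)); [|lra].
  replace (q / (1 - q) ^ 2 * (1 - q)) with (q * / (1 - q)) by (field; lra); lra.
Qed.

Lemma ex_series_majorant (f : C -> C) (a : nat -> C) (r : R) :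
  bounded_analytic f a -> 0 <= r < 1 ->
  ex_series (fun n => Cmod (a n) * r ^ n).
Proof.
  intros Hfa Hr.
  apply (ex_series_nonneg_le _ (fun n => r ^ n)).
  - intros n; pose proof (coef_le_1 f a n Hfa); pose proof (Cmod_ge_0 (a n)).
    pose proof (pow_le r n (proj1 Hr)); nra.
  - apply ex_series_geom; rewrite Rabs_pos_eq; lra.
Qed.

Lemma ex_series_energy (f : C -> C) (a : nat -> C) (r : R) :
  bounded_analytic f a -> 0 <= r < 1 ->
  ex_series (fun n => Cmod (a n) ^ 2 * r ^ (2 * n)).
Proof.
  intros Hfa Hr.
  apply (ex_series_nonneg_le _ (fun n => (r ^ 2) ^ n)).
  - intros n; rewrite <- pow_mult.
    pose proof (coef_le_1 f a n Hfa); pose proof (Cmod_ge_0 (a n)).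
    pose proof (pow_le r (2 * n) (proj1 Hr)).
    assert (0 <= Cmod (a n) ^ 2 <= 1) by nra; nra.
  - apply ex_series_geom; rewrite Rabs_pos_eq; nra.
Qed.

Lemma ex_series_area (f : C -> C) (a : nat -> C) (r : R) :
  bounded_analytic f a -> 0 <= r < 1 ->
  ex_series (fun n => INR n * Cmod (a n) ^ 2 * r ^ (2 * n)).
Proof.
  intros Hfa Hr.
  apply (ex_series_nonneg_le _ (fun n => INR n * (r ^ 2) ^ n)).
  - intros n; rewrite <- pow_mult.
    pose proof (coef_le_1 f a n Hfa); pose proof (Cmod_ge_0 (a n)).
    pose proof (pow_le r (2 * n) (proj1 Hr)); pose proof (pos_INR n).
    assert (0 <= Cmod (a n) ^ 2 <= 1) by nra.
    assert (0 <= INR n * r ^ (2 * n)) by nra.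
    nra.
  - apply ex_series_INR_pow; nra.
Qed.

Lemma norm_f0_sq_eq (f : C -> C) (a : nat -> C) (r : R) :
  bounded_analytic f a -> 0 <= r < 1 ->
  norm_f0_sq a r = Series (fun n => Cmod (a n) ^ 2 * r ^ (2 * n)) - Cmod (a 0%nat) ^ 2.
Proof.
  intros Hfa Hr; rewrite (Series_incr_1 _ (ex_series_energy f a r Hfa Hr)); unfold norm_f0_sq; simpl; ring.
Qed.

(** The induction step adds Carlson's inequalities for the indices [2 * n + 2] and
    [2 * n + 3].  The term with
    [energy a n - al ^ 2] is the part of the geometric tails that
    indices above [2 * n + 1] have yet to contribute to the coefficient of each
    square; with it the step is an identity apart from those two inequalities. *)
Lemma bohr_partial_sum (f : C -> C) (a : nat -> C) (r : R) (n : nat) :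
  bounded_analytic f a -> 0 <= r < 1 ->
  let al := Cmod (a 0%nat) in
  sum_f_R0 (fun k => Cmod (a k) * r ^ k) (2 * n + 1)
  + (/ (1 + al) + r / (1 - r)) * (sum_f_R0 (fun k => Cmod (a k) ^ 2 * r ^ (2 * k)) n - al ^ 2)
  - (energy a n - al ^ 2) * (r ^ (2 * n + 2) / (1 - r))
  <= al + (1 - al ^ 2) * ((r - r ^ (2 * n + 2)) / (1 - r)).
Proof.
  intros Hfa Hr al.
  assert (Hal : 0 <= al) by apply Cmod_ge_0.
  induction n as [|n IH].
  - pose proof (odd_coef_bound f a 0 Hfa) as O; rewrite energy_0 in O; fold al in O.
    cbn [sum_f_R0 Nat.mul Nat.add] in *; rewrite energy_0; fold al.
    replace ((r - r ^ 2) / (1 - r)) with r by (field; lra).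
    apply (Rmult_le_compat_r r) in O; [|lra].
    cbn [pow] in *; lra.
  - pose proof (even_coef_bound f a n Hfa) as Ev; fold al in Ev.
    pose proof (odd_coef_bound f a (S n) Hfa) as Od.
    replace (2 * S n + 1)%nat with (S (S (2 * n + 1))) in * by lia.
    replace (2 * n + 2)%nat with (S (2 * n + 1)) in * by lia.
    replace (2 * S n + 2)%nat with (S (S (S (2 * n + 1)))) by lia.
    rewrite !tech5.
    replace (2 * S n)%nat with (S (2 * n + 1)) by lia.
    rewrite energy_S in *.
    set (m := (2 * n + 1)%nat) in *.
    set (p := r ^ S m) in *.
    change (r ^ S (S m)) with (r * p); change (r ^ S (S (S m))) with (r * (r * p)).
    assert (Hp : 0 <= p) by (apply pow_le; lra).
    set (X := Cmod (a (S m))) in *; set (Y := Cmod (a (S (S m)))) in *.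
    set (Z := Cmod (a (S n)) ^ 2) in *.
    set (M := sum_f_R0 (fun k => Cmod (a k) * r ^ k) m) in *.
    set (P := sum_f_R0 (fun k => Cmod (a k) ^ 2 * r ^ (2 * k)) n) in *.
    set (E := energy a n) in *.
    apply (Rmult_le_compat_r p) in Ev; [|exact Hp].
    apply (Rmult_le_compat_r (r * p)) in Od; [|nra].
    apply Rminus_le_0 in IH; apply Rminus_le_0 in Ev; apply Rminus_le_0 in Od.
    apply Rminus_le_0.
    match type of IH with 0 <= ?u => match type of Ev with 0 <= ?v =>
      match type of Od with 0 <= ?w => replace (_ - _) with (u + v + w) end end end.
    + lra.
    + field; lra.
Qed.

Lemma bohr_inequality (f : C -> C) (a : nat -> C) (r : R) :
  bounded_analytic f a -> 0 <= r < 1 ->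
  majorant_series a r + (/ (1 + Cmod (a 0%nat)) + r / (1 - r)) * norm_f0_sq a r
  <= Cmod (a 0%nat) + (1 - Cmod (a 0%nat) ^ 2) * (r / (1 - r)).
Proof.
  intros Hfa Hr; rewrite (norm_f0_sq_eq f a r Hfa Hr).
  pose proof (fun n => bohr_partial_sum f a r n Hfa Hr) as Hn; cbv zeta in Hn.
  set (al := Cmod (a 0%nat)) in *.
  set (g := / (1 + al) + r / (1 - r)) in *.
  assert (Hlim : is_lim_seq (fun n =>
     sum_f_R0 (fun k => Cmod (a k) * r ^ k) (2 * n + 1)
     + g * (sum_f_R0 (fun k => Cmod (a k) ^ 2 * r ^ (2 * k)) n - al ^ 2))
     (majorant_series a r + g * (Series (fun n => Cmod (a n) ^ 2 * r ^ (2 * n)) - al ^ 2))).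
  { apply is_lim_seq_plus'.
    - apply (is_lim_seq_subseq _ _ (fun n => (2 * n + 1)%nat)).
      + apply eventually_subseq; intros n; lia.
      + apply is_lim_seq_sum, (ex_series_majorant f); assumption.
    - apply is_lim_seq_mult'; [apply is_lim_seq_const|].
      apply is_lim_seq_minus'; [|apply is_lim_seq_const].
      apply is_lim_seq_sum, (ex_series_energy f); assumption. }
  refine (is_lim_seq_le _ _ _ _ _ Hlim (is_lim_seq_const _)); intros n.
  specialize (Hn n); pose proof (energy_le_1 f a n Hfa) as HE.
  assert (Hp : 0 <= r ^ (2 * n + 2) / (1 - r)).
  { apply Rdiv_le_0_compat; [apply pow_le|]; lra. }
  replace ((r - r ^ (2 * n + 2)) / (1 - r))
    with (r / (1 - r) - r ^ (2 * n + 2) / (1 - r)) in Hn by (field; lra).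
  nra.
Qed.

Lemma area_div_PI (a : nat -> C) (r : R) :
  area a r / PI = Series (fun n => INR n * Cmod (a n) ^ 2 * r ^ (2 * n)).
Proof. unfold area; field; apply PI_neq0. Qed.

(** Summation by parts: the stronger bound by [w n] times the plain partial sum
    is preserved by induction. *)
Lemma abel_sum_le (w d : nat -> R) :
  (forall n, 0 <= w n) -> (forall n, w (S n) <= w n) ->
  (forall n, sum_f_R0 d n <= 0) ->
  forall n, sum_f_R0 (fun k => w k * d k) n <= 0.
Proof.
  intros Hw Hdec Hd n.
  enough (sum_f_R0 (fun k => w k * d k) n <= w n * sum_f_R0 d n).
  { specialize (Hw n); specialize (Hd n); nra. }
  induction n as [|n IH]; [apply Rle_refl|].
  rewrite !tech5; specialize (Hdec n); specialize (Hd n); nra.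
Qed.

(** The partial sums of the squared coefficients are compared with those of the
    disk automorphism, and the comparison is transferred by [abel_sum_le] to the
    weights [n * r ^ (2 * n)], decreasing because [r ^ 2 <= 1 / 2]. *)
Lemma area_bound (f : C -> C) (a : nat -> C) (r : R) :
  bounded_analytic f a -> 0 <= r -> r ^ 2 <= 1 / 2 ->
  area a r / PI
  <= (1 - Cmod (a 0%nat) ^ 2) ^ 2 * (r ^ 2 / (1 - Cmod (a 0%nat) ^ 2 * r ^ 2) ^ 2).
Proof.
  intros Hfa Hr0 Hr2.
  assert (Hr : 0 <= r < 1) by nra.
  pose proof (ex_series_area f a r Hfa Hr) as Hex.
  pose proof (Cmod_ge_0 (a 0%nat)) as Hal0; pose proof (coef_le_1 f a 0 Hfa) as Hal1.
  set (q := r ^ 2) in *.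
  set (b := Cmod (a 0%nat) ^ 2).
  assert (Hq : 0 <= q) by apply pow2_ge_0.
  assert (Hb : 0 <= b <= 1) by (unfold b; nra).
  assert (Hbq : 0 <= b * q < 1) by nra.
  set (v := fun k => (1 - b) ^ 2 * b ^ k).
  assert (HS : Series (fun n => INR n * Cmod (a n) ^ 2 * r ^ (2 * n))
               <= Series (fun k => INR (S k) * q ^ S k * v k)).
  { rewrite Series_incr_1 by exact Hex; rewrite Rmult_0_l, Rmult_0_l, Rplus_0_l.
    assert (Hex1 := proj1 (ex_series_incr_1 _) Hex).
    assert (Hex2 : ex_series (fun k => INR (S k) * q ^ S k * v k)).
    { apply (ex_series_nonneg_le _ (fun k => INR (S k) * q ^ S k)).
      - intros k; unfold v.
        assert (0 <= b ^ k <= 1).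
        { split; [apply pow_le; lra | rewrite <- (pow1 k); apply pow_incr; lra]. }
        assert (0 <= (1 - b) ^ 2 <= 1) by nra.
        assert (0 <= (1 - b) ^ 2 * b ^ k <= 1) by nra.
        assert (0 <= INR (S k) * q ^ S k)
          by (apply Rmult_le_pos; [apply pos_INR | apply pow_le; lra]).
        nra.
      - apply (ex_series_incr_1 (K := R_AbsRing) (V := R_NormedModule) (fun k => INR k * q ^ k)).
        apply ex_series_INR_pow; lra. }
    apply Rminus_le; rewrite <- Series_minus by assumption.
    apply Series_le_of_partial_sums.
    - apply (ex_series_minus (K := R_AbsRing) (V := R_NormedModule)); assumption.
    - intros n.
      rewrite (sum_eq _ (fun k => (INR (S k) * q ^ S k) * (Cmod (a (S k)) ^ 2 - v k))).
      2:{ intros k _; rewrite pow_mult; unfold q; ring. }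
      apply abel_sum_le; clear n; intros n.
      + apply Rmult_le_pos; [apply pos_INR | apply pow_le; lra].
      + rewrite (S_INR (S n)), (S_INR n); cbn [pow].
        pose proof (pos_INR n); pose proof (pow_le q n Hq).
        assert (0 <= q * q ^ n * (INR n + 1 - (INR n + 2) * q)) by
          (apply Rmult_le_pos; nra).
        nra.
      + rewrite <- (Rminus_diag_eq (1 - (1 - b) * b ^ S n - b) _ eq_refl).
        assert (Ev : sum_f_R0 v n = 1 - (1 - b) * b ^ S n - b).
        { unfold v; induction n as [|n IH]; [simpl; ring|].
          rewrite tech5, IH; simpl; ring. }
        rewrite minus_sum, Ev; apply Rplus_le_compat_r.
        pose proof (energy_upper_bound f a (S n) Hfa) as HE; unfold energy in HE.
        rewrite decomp_sum in HE by lia; cbn [pred] in HE; fold b in HE; lra. }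
  assert (Hval : Series (fun k => INR (S k) * q ^ S k * v k)
                 = (1 - b) ^ 2 * (q / (1 - b * q) ^ 2)).
  { pose proof (Series_geom (b * q) ltac:(rewrite Rabs_pos_eq; lra)) as Hg.
    assert (Hg' : ex_series (fun n => (b * q) ^ n))
      by (apply ex_series_geom; rewrite Rabs_pos_eq; lra).
    pose proof (ex_series_INR_pow (b * q) Hbq) as Hn'.
    pose proof (Series_INR_pow (b * q) Hbq) as Hn.
    transitivity (((1 - b) ^ 2 * q)
       * Series (fun k => INR k * (b * q) ^ k + (b * q) ^ k)).
    - rewrite <- Series_scal_l; apply Series_ext; intros k.
      unfold v; rewrite S_INR, Rpow_mult_distr; simpl; ring.
    - rewrite (Series_plus (fun k => INR k * (b * q) ^ k) (fun k => (b * q) ^ k)), Hg, Hn by assumption; field; lra. }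
  rewrite area_div_PI, <- Hval; exact HS.
Qed.

(** * The extremal parameter *)

Definition crit_num (x : R) : R := (5 + x) * (13 + 4 * x - x ^ 2) * (9 - x ^ 2) ^ 2.
Definition crit_den (x : R) : R := (1 - x) * (1 + x) ^ 4.

(** The linear term of [psi] outweighs all the decreasing terms together: on the
    unit interval the latter have Lipschitz constant at most
    [4 * 6 + 76 * 5 + 1344 * 4 + 1396 * 3 = 9968 < 15804]. *)
Lemma psi_increasing (u v : R) : 0 <= u -> u < v -> v <= 1 -> psi u < psi v.
Proof.
  intros Hu Huv Hv.
  assert (Hpow : forall k, u ^ k <= v ^ k) by (intros k; apply pow_incr; lra).
  assert (Hlip : forall k, v ^ k - u ^ k <= INR k * (v - u)).
  { induction k as [|k IH]; [simpl; lra|].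
    assert (0 <= u ^ k <= 1).
    { split; [apply pow_le; lra | rewrite <- (pow1 k); apply pow_incr; lra]. }
    specialize (Hpow k); rewrite S_INR; cbn [pow]; nra. }
  pose proof (Hpow 8%nat); pose proof (Hpow 7%nat); pose proof (Hpow 2%nat).
  pose proof (Hlip 6%nat) as H6; pose proof (Hlip 5%nat) as H5.
  pose proof (Hlip 4%nat) as H4; pose proof (Hlip 3%nat) as H3.
  rewrite INR_IZR_INZ in H6, H5, H4, H3; simpl IZR in H6, H5, H4, H3.
  unfold psi; lra.
Qed.

Lemma psi_root_exists :
  exists t, 587459 / 10 ^ 6 - 5 / 10 ^ 7 <= t <= 587459 / 10 ^ 6 + 5 / 10 ^ 7 /\ psi t = 0.
Proof.
  destruct (IVT psi (587459 / 10 ^ 6 - 5 / 10 ^ 7) (587459 / 10 ^ 6 + 5 / 10 ^ 7))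
    as [t Ht].
  - unfold psi; reg.
  - lra.
  - unfold psi; lra.
  - unfold psi; lra.
  - exists t; exact Ht.
Qed.

Lemma crit_num_psi (t : R) : psi t = 0 ->
  crit_num t * (5 * t - 3)
  = (- 2673 + 2502 * t + 2025 * t ^ 2 - 332 * t ^ 3 - 255 * t ^ 4
     + 6 * t ^ 5 + 7 * t ^ 6) * (1 - t ^ 2).
Proof.
  intros H; apply Rminus_diag_uniq; rewrite <- H; unfold crit_num, psi; ring.
Qed.

Lemma lambda_eq (t : R) : 0 <= t < 1 -> 5 * t - 3 <> 0 -> psi t = 0 ->
  162 * lambda t * crit_den t = crit_num t.
Proof.
  intros Ht H3 H; apply crit_num_psi in H.
  apply (Rmult_eq_reg_r (5 * t - 3)); [|exact H3].
  rewrite H; unfold lambda, crit_den; field; lra.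
Qed.

(** The derivative of [crit_num]. *)
Definition crit_num' (t : R) : R :=
  - 7 * t ^ 6 - 6 * t ^ 5 + 255 * t ^ 4 + 332 * t ^ 3 - 2025 * t ^ 2 - 2502 * t + 2673.

(** [psi t] equals [(1 - t ^ 2) * crit_num' t - (3 - 5 * t) * crit_num t], and
    [(1 + t) ^ 3 * (3 - 5 * t)] is the derivative of [crit_den]: a root of [psi] is a
    critical point of [crit_num - c * crit_den]. *)
Lemma crit_eq (t c : R) : 0 <= t < 1 -> psi t = 0 -> c * crit_den t = crit_num t ->
  crit_num' t = c * ((1 + t) ^ 3 * (3 - 5 * t)).
Proof.
  intros Ht H Hc; apply (Rmult_eq_reg_r (1 - t ^ 2)); [|nra].
  transitivity (c * crit_den t * (3 - 5 * t)); [|unfold crit_den; ring].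
  rewrite Hc; apply Rminus_diag_uniq; transitivity (psi t); [|exact H].
  unfold crit_num', crit_num, psi; ring.
Qed.

(** The small denominator [5 * t - 3] magnifies the uncertainty on [t] in the formula
    for [lambda].  The quotient [crit_num / crit_den] of [lambda_eq] is stationary at
    the root, hence nearly constant around it. *)
Lemma lambda_bounds (t : R) :
  587459 / 10 ^ 6 - 5 / 10 ^ 7 <= t <= 587459 / 10 ^ 6 + 5 / 10 ^ 7 -> psi t = 0 ->
  14796883 / 10 ^ 6 <= lambda t <= 14796883 / 10 ^ 6 + 12 / 10 ^ 5.
Proof.
  intros Ht H; cbn [pow] in Ht.
  assert (E := lambda_eq t ltac:(lra) ltac:(lra) H).
  assert (Hd : 0 < crit_den t).
  { unfold crit_den; apply Rmult_lt_0_compat; [|apply pow_lt]; lra. }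
  (* In powers of the deviation [e] everything beyond the linear term is below
     10 ^ -12 times its coefficient, which leaves linear inequalities. *)
  set (e := t - 587459 / 1000000).
  assert (He : - (5 / 10000000) <= e <= 5 / 10000000) by (unfold e; lra).
  replace t with (587459 / 1000000 + e) in * by (unfold e; ring).
  assert (He2 : 0 <= e ^ 2 <= 1 / 1000000000000) by nra.
  assert (He3 : forall k, - (1 / 1000000000000) <= e ^ (2 + k) <= 1 / 1000000000000).
  { intros k; apply Rabs_le_between.
    rewrite pow_add, Rabs_mult, (Rabs_pos_eq (e ^ 2)), <- RPow_abs by lra.
    assert (0 <= Rabs e ^ k <= 1).
    { split; [apply pow_le, Rabs_pos|].
      rewrite <- (pow1 k); apply pow_incr; split; [apply Rabs_pos|].
      apply Rabs_le; lra. }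
    nra. }
  pose proof (He3 1%nat) as H3; pose proof (He3 2%nat) as H4; pose proof (He3 3%nat) as H5.
  pose proof (He3 4%nat) as H6; pose proof (He3 5%nat) as H7; clear He3.
  set (l := lambda (587459 / 1000000 + e)) in *; clearbody l.
  cbn [pow Nat.add] in *.
  set (x := 587459 / 1000000 + e) in *.
  split; apply (Rmult_le_reg_r (162 * crit_den x)); try lra;
    replace (l * (162 * crit_den x)) with (crit_num x) by lra;
    unfold crit_num, crit_den, x; cbn [pow]; lra.
Qed.

(** [t] is a double zero of the difference, and [- a ^ 5 + q4 * a ^ 4 + ... + q0] is
    the quotient by [(a - t) ^ 2], computed by synthetic division.  Its coefficients
    [q0], ..., [q3] are large and positive, which settles its sign. *)
Lemma crit_num_ge (t c a : R) :
  587459 / 10 ^ 6 - 5 / 10 ^ 7 <= t <= 587459 / 10 ^ 6 + 5 / 10 ^ 7 ->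
  2397 <= c <= 2398 -> psi t = 0 -> c * crit_den t = crit_num t ->
  0 <= a <= 1 -> c * crit_den a <= crit_num a.
Proof.
  intros Ht Hc H Hct Ha; cbn [pow] in Ht.
  pose proof (crit_eq t c ltac:(lra) H Hct) as Hct'.
  set (q4 := - 1 - 2 * t).
  set (q3 := 51 + c + 2 * t * q4 + t ^ 2).
  set (q2 := 83 + 3 * c + 2 * t * q3 - t ^ 2 * q4).
  set (q1 := - 675 + 2 * c + 2 * t * q2 - t ^ 2 * q3).
  set (q0 := - 1251 - 2 * c + 2 * t * q1 - t ^ 2 * q2).
  apply Rminus_le_0.
  replace (crit_num a - c * crit_den a)
    with ((a - t) ^ 2 * (- a ^ 5 + q4 * a ^ 4 + q3 * a ^ 3 + q2 * a ^ 2 + q1 * a + q0)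
          + (a - t) * (crit_num' t - c * ((1 + t) ^ 3 * (3 - 5 * t)))
          + (crit_num t - c * crit_den t)).
  2:{ unfold crit_num, crit_num', crit_den, q0, q1, q2, q3, q4; ring. }
  rewrite Hct, Hct', !Rminus_diag, Rmult_0_r, !Rplus_0_r.
  apply Rmult_le_pos; [apply pow2_ge_0|].
  assert (Ht2 : 345 / 1000 <= t ^ 2 <= 346 / 1000) by (cbn [pow]; nra).
  assert (B4 : - 22 / 10 <= q4 <= 0) by (unfold q4; lra).
  assert (B3 : 2440 <= q3 <= 2450) by (unfold q3; nra).
  assert (B2 : 10000 <= q2 <= 10200) by (unfold q2; nra).
  assert (B1 : 14000 <= q1 <= 16000) by (unfold q1; nra).
  assert (B0 : 5000 <= q0) by (unfold q0; nra).
  assert (Hp : forall k, 0 <= a ^ k <= 1).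
  { intros k; split; [apply pow_le; lra | rewrite <- (pow1 k); apply pow_incr; lra]. }
  pose proof (Hp 5%nat); pose proof (Hp 4%nat); pose proof (Hp 3%nat); pose proof (Hp 2%nat).
  clearbody q0 q1 q2 q3 q4.
  assert (0 <= q3 * a ^ 3) by (apply Rmult_le_pos; lra).
  assert (0 <= q2 * a ^ 2) by (apply Rmult_le_pos; lra).
  assert (0 <= q1 * a) by (apply Rmult_le_pos; lra).
  assert (- 3 <= q4 * a ^ 4) by nra.
  lra.
Qed.

(** The value of the functional at [r = 1 / 3] for the disk automorphism with
    parameter [a]. *)
Definition extremal_value (lam a : R) : R :=
  a + (1 - a ^ 2) / 2 + 8 / 9 * (9 * (1 - a ^ 2) ^ 2 / (9 - a ^ 2) ^ 2)
  + lam * (9 * (1 - a ^ 2) ^ 2 / (9 - a ^ 2) ^ 2) ^ 2.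

(** It rests on the factorization
    [(9 - a ^ 2) ^ 2 - 16 * (1 + a) ^ 2 = (1 - a) * (5 + a) * (13 + 4 * a - a ^ 2)]; this is
    where the constant 8/9 makes the quotient by [1 - a] possible. *)
Lemma extremal_value_deficit (lam a : R) : 0 <= a <= 1 ->
  1 - extremal_value lam a
  = (1 - a) ^ 3 * (crit_num a - 162 * lam * crit_den a) / (2 * (9 - a ^ 2) ^ 4).
Proof.
  intros Ha; unfold extremal_value, crit_num, crit_den; field; nra.
Qed.

Lemma bohr_functional_le_extremal_value (f : C -> C) (a : nat -> C) (lam r : R) :
  bounded_analytic f a -> 0 <= lam -> 0 <= r <= 1 / 3 ->
  bohr_functional lam a r <= extremal_value lam (Cmod (a 0%nat)).
Proof.
  intros Hfa Hlam Hr.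
  pose proof (bohr_inequality f a r Hfa ltac:(lra)) as HB.
  pose proof (area_bound f a r Hfa (proj1 Hr) ltac:(nra)) as HA.
  assert (HA0 : 0 <= area a r / PI).
  { rewrite area_div_PI.
    refine (is_lim_seq_le _ _ _ _ _ (is_lim_seq_const 0)
              (is_lim_seq_sum _ (ex_series_area f a r Hfa ltac:(lra)))).
    intros n; apply cond_pos_sum; intros k.
    apply Rmult_le_pos; [|apply pow_le; lra].
    apply Rmult_le_pos; [apply pos_INR | apply pow2_ge_0]. }
  pose proof (Cmod_ge_0 (a 0%nat)) as H0; pose proof (coef_le_1 f a 0 Hfa) as H1.
  unfold bohr_functional, extremal_value.
  set (al := Cmod (a 0%nat)) in *; set (S := area a r / PI) in *.
  assert (Hr1 : r / (1 - r) <= 1 / 2) by (apply Rle_div_l; lra).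
  assert (Hal : 0 <= al ^ 2 <= 1) by nra.
  set (T := 9 * (1 - al ^ 2) ^ 2 / (9 - al ^ 2) ^ 2).
  assert (HT : S <= T).
  { eapply Rle_trans; [exact HA|].
    replace T with ((1 - al ^ 2) ^ 2 * ((1 / 9) / (1 - al ^ 2 * (1 / 9)) ^ 2))
      by (unfold T; field; lra).
    assert (Hr2 : 0 <= r ^ 2 <= 1 / 9) by nra.
    assert (Hd : 0 < 1 - al ^ 2 * (1 / 9) <= 1 - al ^ 2 * r ^ 2) by nra.
    apply Rmult_le_compat_l; [apply pow2_ge_0|].
    apply Rmult_le_compat; try lra.
    - apply Rlt_le, Rinv_0_lt_compat, pow_lt; lra.
    - apply Rinv_le_contravar; [apply pow_lt; lra | apply pow_incr; lra]. }
  assert (S ^ 2 <= T ^ 2) by (apply pow_incr; lra).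
  nra.
Qed.

(** * The extremal function *)

Definition automorphism_coef (t : R) (n : nat) : C :=
  match n with
  | 0%nat => RtoC t
  | S k => RtoC (- ((1 - t ^ 2) * t ^ k))
  end.

Lemma one_minus_mult_neq_0 (t : R) (z : C) :
  0 <= t < 1 -> Cmod z < 1 -> (1 - RtoC t * z)%C <> 0%C.
Proof.
  intros Ht Hz E.
  assert (E' : (RtoC t * z)%C = 1%C).
  { replace (RtoC t * z)%C with (1 - (1 - RtoC t * z))%C by ring; rewrite E; ring. }
  apply (f_equal Cmod) in E'; rewrite Cmod_mult, Cmod_1, Cmod_R, Rabs_pos_eq in E' by lra.
  pose proof (Cmod_ge_0 z); nra.
Qed.

Lemma cpoly_automorphism_coef (t : R) (z : C) (n : nat) :
  0 <= t < 1 -> Cmod z < 1 ->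
  (cpoly (automorphism_coef t) n z - disk_automorphism t z)%C
  = ((1 - RtoC t ^ 2) * z * (RtoC t * z) ^ n / (1 - RtoC t * z))%C.
Proof.
  intros Ht Hz; pose proof (one_minus_mult_neq_0 t z Ht Hz) as Hd.
  unfold disk_automorphism; induction n as [|n IH].
  - rewrite cpoly_0; cbn [automorphism_coef Cpow]; field; exact Hd.
  - rewrite cpoly_S.
    match goal with |- (?p + ?u - ?w)%C = _ =>
      replace (p + u - w)%C with ((p - w) + u)%C by ring end.
    rewrite IH; cbn [automorphism_coef].
    rewrite RtoC_opp, RtoC_mult, RtoC_minus, !RtoC_pow, !Cpow_mult_l; cbn [Cpow].
    field; exact Hd.
Qed.

Lemma disk_automorphism_bounded (t : R) :
  0 <= t < 1 -> bounded_analytic (disk_automorphism t) (automorphism_coef t).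
Proof.
  intros Ht z Hz; pose proof (one_minus_mult_neq_0 t z Ht Hz) as Hd.
  pose proof (proj1 (Cmod_gt_0 _) Hd) as Hm.
  split.
  - apply is_pseries_C_iff; intros eps Heps.
    set (K := Cmod ((1 - RtoC t ^ 2) * z)%C / Cmod (1 - RtoC t * z)%C).
    assert (HK : 0 <= K) by (apply Rdiv_le_0_compat; [apply Cmod_ge_0 | exact Hm]).
    destruct (pow_lt_1_zero t (Rabs_def1 _ _ (proj2 Ht) ltac:(lra)) (eps / (K + 1)))
      as [N HN]; [apply Rdiv_lt_0_compat; lra|].
    exists N; intros n Hn; specialize (HN n Hn).
    rewrite Rabs_pos_eq in HN by (apply pow_le; lra).
    rewrite cpoly_automorphism_coef, Cmod_div, Cmod_mult by assumption.
    replace (_ / _) with (K * Cmod ((RtoC t * z) ^ n)%C) by (unfold K; field; lra).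
    assert (Hz0 : 0 <= Cmod z ^ n <= 1).
    { pose proof (Cmod_ge_0 z); split; [apply pow_le; lra|].
      rewrite <- (pow1 n); apply pow_incr; lra. }
    assert (Htn : 0 <= t ^ n) by (apply pow_le; lra).
    rewrite Cmod_pow, Cmod_mult, Cmod_R, Rabs_pos_eq, Rpow_mult_distr by lra.
    apply Rlt_div_r in HN; [|lra].
    assert (t ^ n * Cmod z ^ n <= t ^ n) by nra.
    nra.
  - unfold disk_automorphism; rewrite Cmod_div by exact Hd; apply Rle_div_l; [exact Hm|].
    rewrite Rmult_1_l; apply Rsqr_incr_0; try apply Cmod_ge_0; rewrite !Rsqr_pow2, !Cmod2_alt.
    assert (Hz2 : Cmod z ^ 2 < 1) by (pose proof (Cmod_ge_0 z); nra).
    rewrite Cmod2_alt in Hz2; destruct z as [x y]; simpl in *.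
    assert (0 <= (1 - t * t) * (1 - x * x - y * y)) by (apply Rmult_le_pos; nra).
    nra.
Qed.

Lemma Series_scal_geom (k x : R) :
  Rabs x < 1 -> Series (fun n => k * x ^ n) = k / (1 - x).
Proof. intros Hx; rewrite Series_scal_l, Series_geom by exact Hx; reflexivity. Qed.

Lemma bohr_functional_automorphism (lam t : R) :
  0 <= t < 1 ->
  bohr_functional lam (automorphism_coef t) (1 / 3) = extremal_value lam t.
Proof.
  intros Ht; pose proof (disk_automorphism_bounded t Ht) as HB.
  assert (Hm0 : Cmod (automorphism_coef t 0) = t)
    by (cbn [automorphism_coef]; rewrite Cmod_R; apply Rabs_pos_eq; lra).
  assert (HmS : forall k, Cmod (automorphism_coef t (S k)) = (1 - t ^ 2) * t ^ k).
  { intros k; cbn [automorphism_coef]; rewrite Cmod_R, Rabs_Ropp; apply Rabs_pos_eq.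
    apply Rmult_le_pos; [nra | apply pow_le; lra]. }
  assert (Ht2 : 0 <= t ^ 2 < 1) by nra.
  assert (Hsq : forall k, Cmod (automorphism_coef t (S k)) ^ 2 * (1 / 3) ^ (2 * S k)
                = (1 - t ^ 2) ^ 2 / 9 * (t ^ 2 / 9) ^ k).
  { intros k; rewrite HmS, pow_mult.
    replace (t ^ 2 / 9) with (t ^ 2 * (1 / 3) ^ 2) by field.
    rewrite !Rpow_mult_distr, <- (pow_mult t), <- (pow_mult t), (Nat.mul_comm k).
    rewrite <- (tech_pow_Rmult ((1 / 3) ^ 2)).
    set (u := t ^ (2 * k)); set (v := ((1 / 3) ^ 2) ^ k); field. }
  assert (M : majorant_series (automorphism_coef t) (1 / 3)
              = t + (1 - t ^ 2) / 3 / (1 - t / 3)).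
  { unfold majorant_series.
    rewrite Series_incr_1 by (apply (ex_series_majorant _ _ _ HB); lra).
    rewrite Hm0, <- Series_scal_geom by (rewrite Rabs_pos_eq; lra); f_equal; [simpl; ring|].
    apply Series_ext; intros k; rewrite HmS.
    replace (t / 3) with (t * (1 / 3)) by field.
    rewrite Rpow_mult_distr; simpl; field. }
  assert (N : norm_f0_sq (automorphism_coef t) (1 / 3)
              = (1 - t ^ 2) ^ 2 / 9 / (1 - t ^ 2 / 9)).
  { unfold norm_f0_sq.
    rewrite <- Series_scal_geom by (rewrite Rabs_pos_eq; lra).
    apply Series_ext, Hsq. }
  assert (A : area (automorphism_coef t) (1 / 3) / PI
              = 9 * (1 - t ^ 2) ^ 2 / (9 - t ^ 2) ^ 2).
  { rewrite area_div_PI, Series_incr_1 by (apply (ex_series_area _ _ _ HB); lra).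
    rewrite Rmult_0_l, Rmult_0_l, Rplus_0_l.
    assert (Hq : 0 <= t ^ 2 / 9 < 1) by lra.
    transitivity ((1 - t ^ 2) ^ 2 / 9
      * Series (fun k => INR k * (t ^ 2 / 9) ^ k + (t ^ 2 / 9) ^ k)).
    - rewrite <- Series_scal_l; apply Series_ext; intros k.
      rewrite Rmult_assoc, Hsq, S_INR; ring.
    - rewrite (Series_plus (fun k => INR k * (t ^ 2 / 9) ^ k) (fun k => (t ^ 2 / 9) ^ k)),
        Series_geom, Series_INR_pow; try exact Hq.
      + field; lra.
      + rewrite Rabs_pos_eq; lra.
      + apply ex_series_INR_pow, Hq.
      + apply ex_series_geom; rewrite Rabs_pos_eq; lra. }
  unfold bohr_functional; rewrite M, N, A, Hm0; unfold extremal_value.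
  apply Rplus_eq_compat_r, Rplus_eq_compat_r; field; nra.
Qed.

Theorem theorem1 :
  exists t : R,
    unique (fun u : R => 0 < u < 1 /\ psi u = 0) t /\
    Rabs (t - 587459 / 10 ^ 6) <= 5 / 10 ^ 7 /\
    Rabs (lambda t - 14796883 / 10 ^ 6) <= 12 / 10 ^ 5 /\
    (forall (f : C -> C) (a : nat -> C), bounded_analytic f a ->
       forall r : R, 0 <= r <= 1 / 3 -> bohr_functional (lambda t) a r <= 1) /\
    (exists b : nat -> C,
       bounded_analytic (disk_automorphism t) b /\
       bohr_functional (lambda t) b (1 / 3) = 1).
Proof.
  destruct psi_root_exists as [t [Ht Hpsi]].
  pose proof (lambda_bounds t Ht Hpsi) as Hlam.
  assert (Ht' : 58 / 100 < t < 59 / 100) by lra.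
  pose proof (lambda_eq t ltac:(lra) ltac:(lra) Hpsi) as Hcrit.
  exists t; repeat split; try lra.
  - intros u [Hu Hpu].
    destruct (Rtotal_order t u) as [Hlt | [Heq | Hgt]]; [|exact Heq|].
    + pose proof (psi_increasing t u ltac:(lra) Hlt ltac:(lra)); lra.
    + pose proof (psi_increasing u t ltac:(lra) Hgt ltac:(lra)); lra.
  - apply Rabs_le; lra.
  - apply Rabs_le; lra.
  - intros f a Hfa r Hr.
    eapply Rle_trans;
      [apply (bohr_functional_le_extremal_value f); [exact Hfa | lra | exact Hr]|].
    pose proof (Cmod_ge_0 (a 0%nat)) as H0; pose proof (coef_le_1 f a 0 Hfa) as H1.
    set (al := Cmod (a 0%nat)) in *.
    apply Rminus_le_0; rewrite extremal_value_deficit by lra.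
    apply Rdiv_le_0_compat; [apply Rmult_le_pos|].
    + apply pow_le; lra.
    + apply -> Rminus_le_0; apply (crit_num_ge t); try assumption; lra.
    + apply Rmult_lt_0_compat; [lra | apply pow_lt; nra].
  - exists (automorphism_coef t); split.
    + apply disk_automorphism_bounded; lra.
    + rewrite bohr_functional_automorphism by lra.
      apply Rminus_diag_uniq_sym; rewrite extremal_value_deficit by lra.
      rewrite Hcrit, Rminus_diag, Rmult_0_r; apply Rmult_0_l.
Qed.
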